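(* Let $f:[0,1]\times\mathbb{R}^8\to\mathbb{R}$ be continuous, let $a,b,c,d\in\mathbb{R}$, let $M>0$, and let $g$, $M_0,\dots,M_3$ and $\mathcal{D}_M$ be as defined in the context. Assume that: (i) the functions $\varphi_k$ ($k=0,1,2,3$) are continuous functions from $[0,1]$ to $[0,1]$; (ii) the function $f(t,u,\bar u,y,\bar y,v,\bar v,z,\bar z)$ is continuous and bounded by $M$ in $\mathcal{D}_M$, i.e. $|f(t,u,\bar u,y,\bar y,v,\bar v,z,\bar z)|\le M$ for all $(t,u,\bar u,y,\bar y,v,\bar v,z,\bar z)\in\mathcal{D}_M$; (iii) $f$ satisfies the Lipschitz condition in $\mathcal{D}_M$ with coefficients $L_i\ge 0$ ($i=0,\dots,7$): $$\begin{aligned}&|f(t,u_2,\bar u_2,y_2,\bar y_2,v_2,\bar v_2,z_2,\bar z_2)-f(t,u_1,\bar u_1,y_1,\bar y_1,v_1,\bar v_1,z_1,\bar z_1)|\\ &\quad\le L_0|u_2-u_1|+L_1|\bar u_2-\bar u_1|+L_2|y_2-y_1|+L_3|\bar y_2-\bar y_1|\\ &\qquad+L_4|v_2-v_1|+L_5|\bar v_2-\bar v_1|+L_6|z_2-z_1|+L_7|\bar z_2-\bar z_1|\end{aligned}$$ for all $(t,u_i,\bar u_i,y_i,\bar y_i,v_i,\bar v_i,z_i,\bar z_i)\in\mathcal{D}_M$ ($i=1,2$); (iv) $q:=(L_0+L_1)M_0+(L_2+L_3)M_1+(L_4+L_5)M_2+(L_6+L_7)M_3<1$. Then the boundary value problem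 $$u''''(t)=f\big(t,u(t),u(\varphi_0(t)),u'(t),u'(\varphi_1(t)),u''(t),u''(\varphi_2(t)),u'''(t),u'''(\varphi_3(t))\big),\quad 0<t<1,$$ $$u(0)=a,\quad u(1)=b,\quad u'(0)=c,\quad u'(1)=d$$ has a unique solution $u(t)\in C^4[0,1]$, and this solution satisfies the estimate $$|u^{(i)}(t)|\le\|g^{(i)}\|+M_iM\qquad\text{for all }t\in[0,1],\ i=0,1,2,3.$$
   Context: $\|v\|=\max_{0\le t\le1}|v(t)|$ for $v\in C[0,1]$. $g$ is the polynomial of degree at most three with $g(0)=a$, $g(1)=b$, $g'(0)=c$, $g'(1)=d$. The constants are $$M_0=\tfrac1{384},\quad M_1=\tfrac1{72\sqrt3},\quad M_2=\tfrac1{12},\quad M_3=\tfrac12 .$$ For $M>0$, $$\mathcal{D}_M=\Big\{(t,u,\bar u,y,\bar y,v,\bar v,z,\bar z)\ \Big|\ 0\le t\le1;\ |u|,|\bar u|\le\|g\|+M_0M;\ |y|,|\bar y|\le\|g'\|+M_1M;\ |v|,|\bar v|\le\|g''\|+M_2M;\ |z|,|\bar z|\le\|g'''\|+M_3M\Big\}.$$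
   Formalization: Uniqueness is asserted only among solutions in C^4[0,1] that satisfy the estimate |u^(i)(t)| ≤ ||g^(i)|| + M_i M (i=0..3); uniqueness in all of C^4[0,1] fails, since f is only constrained by continuity outside D_M. *)

(* Defs.v *)
(* Real analysis over Stdlib's [R] with Coquelicot. *)
From Stdlib Require Import Reals Lra.
From Coquelicot Require Import Coquelicot.
Open Scope R_scope.

Definition I01 (t : R) : Prop := 0 <= t <= 1.

(* The maximum norm of C[0,1], written as a supremum so as to be total;
   [norm01_is_max] shows that it is the maximum when [v] is continuous. *)
Definition norm01 (v : R -> R) : R :=
  real (Lub_Rbar (fun x => exists t, I01 t /\ x = Rabs (v t))).

Lemma norm01_is_max (v : R -> R) :
  (forall t, I01 t -> continuity_pt v t) ->
  (exists t, I01 t /\ Rabs (v t) = norm01 v) /\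
  (forall t, I01 t -> Rabs (v t) <= norm01 v).
Proof.
intros Hv.
assert (Ha : forall t, 0 <= t <= 1 -> continuity_pt (fun x => Rabs (v x)) t).
{ intros t Ht.
  apply (continuity_pt_comp v Rabs); [now apply Hv | apply Rcontinuity_abs]. }
destruct (continuity_ab_maj _ 0 1 Rle_0_1 Ha) as [m [Hm Im]].
assert (E : norm01 v = Rabs (v m)).
{ unfold norm01; rewrite (is_lub_Rbar_unique _ (Finite (Rabs (v m)))); [easy|].
  split.
  - intros x [t [It ->]]; exact (Hm t It).
  - intros l Hl; apply Hl; now exists m. }
rewrite E; split; [now exists m | exact Hm].
Qed.

(* Derivative relative to [0,1]: Coquelicot's [is_derive] with the neighbourhood
   filter restricted to [0,1], hence one-sided at 0 and at 1. Values of [u]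
   outside [0,1] play no role. *)
Definition is_derive01 (u : R -> R) (t l : R) : Prop :=
  filterdiff u (within I01 (locally t)) (fun h : R => scal h l).

Definition ex_derive01 (u : R -> R) (t : R) : Prop :=
  exists l, is_derive01 u t l.

Definition Derive01 (u : R -> R) (t : R) : R := iota (is_derive01 u t).

Lemma is_derive01_unique (u : R -> R) (t l : R) :
  I01 t -> is_derive01 u t l -> Derive01 u t = l.
Proof.
intros It H.
apply (iota_unique (V := R_CompleteNormedModule)); [|exact H].
intros l' H'.
destruct (Req_dec l' l) as [->|Hne]; [easy|exfalso].
assert (Hlim : is_filter_lim (within I01 (locally t)) t).
{ intros P HP; unfold within; revert HP; apply filter_imp; auto. }
pose proof (Rabs_pos_lt (l' - l) ltac:(lra)) as Hpos.
pose (e := mkposreal (Rabs (l' - l) / 4) ltac:(lra)).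
generalize (filter_and _ _ (proj2 H t Hlim e) (proj2 H' t Hlim e)).
intros [d Hd].
pose (h := Rmin (d / 2) (1 / 2)).
assert (Hh : 0 < h /\ h < d /\ h <= 1 / 2).
{ unfold h; pose proof (cond_pos d).
  pose proof (Rmin_l (d / 2) (1 / 2)); pose proof (Rmin_r (d / 2) (1 / 2)).
  assert (0 < Rmin (d / 2) (1 / 2)) by (apply Rmin_glb_lt; lra); lra. }
assert (exists s, I01 s /\ Rabs (s - t) = h) as [s [Is Hs]].
{ unfold I01 in *; destruct (Rle_dec t (1 / 2)).
  - exists (t + h); split; [lra|]; rewrite Rabs_right; lra.
  - exists (t - h); split; [lra|]; rewrite Rabs_left; lra. }
assert (Hb : ball t d s).
{ change (Rabs (s - t) < d); lra. }
destruct (Hd s Hb Is) as [A B].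
change (Rabs (u s - u t - (s - t) * l) <= e * Rabs (s - t)) in A.
change (Rabs (u s - u t - (s - t) * l') <= e * Rabs (s - t)) in B.
rewrite Hs in A, B; simpl in A, B.
assert (C : Rabs ((s - t) * (l' - l)) <= 2 * (Rabs (l' - l) / 4 * h)).
{ replace ((s - t) * (l' - l))
    with ((u s - u t - (s - t) * l) - (u s - u t - (s - t) * l')) by ring.
  eapply Rle_trans; [apply Rabs_triang|]; rewrite Rabs_Ropp; lra. }
rewrite Rabs_mult, Hs in C; nra.
Qed.

Fixpoint Derive01_n (u : R -> R) (n : nat) : R -> R :=
  match n with
  | O => u
  | S k => Derive01 (Derive01_n u k)
  end.

Definition C4_01 (u : R -> R) : Prop :=
  (forall k, (k < 4)%nat -> forall t, I01 t -> ex_derive01 (Derive01_n u k) t) /\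
  continuous_on I01 (Derive01_n u 4).

(* Arguments (t, u, ubar, y, ybar, v, vbar, z, zbar). *)
Definition R9 : Type := R * R * R * R * R * R * R * R * R.

Definition dom01 (p : R9) : Prop :=
  let '(t, _, _, _, _, _, _, _, _) := p in I01 t.

(* The cubic is unique; [cubic_interpolant_ex] gives existence. *)
Definition cubic_interpolant (a b c d : R) (g : R -> R) : Prop :=
  (exists c0 c1 c2 c3,
     forall t, g t = c0 + c1 * t + c2 * t ^ 2 + c3 * t ^ 3) /\
  g 0 = a /\ g 1 = b /\ Derive g 0 = c /\ Derive g 1 = d.

Lemma cubic_interpolant_ex (a b c d : R) :
  exists g, cubic_interpolant a b c d g.
Proof.
exists (fun t => a + c * t + (3 * (b - a) - 2 * c - d) * t ^ 2
                 + (c + d - 2 * (b - a)) * t ^ 3).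
split; [now do 4 eexists|].
split; [ring|]; split; [ring|].
split; apply is_derive_unique; auto_derive; trivial; ring.
Qed.

Definition Mconst (k : nat) : R :=
  match k with
  | 0 => 1 / 384
  | 1 => 1 / (72 * sqrt 3)
  | 2 => 1 / 12
  | _ => 1 / 2
  end.

Definition apriori_bound (g : R -> R) (M : R) (k : nat) : R :=
  norm01 (Derive_n g k) + Mconst k * M.

Definition DM (g : R -> R) (M : R) (p : R9) : Prop :=
  let '(t, u, ub, y, yb, v, vb, z, zb) := p in
  I01 t /\
  (Rabs u <= apriori_bound g M 0 /\ Rabs ub <= apriori_bound g M 0) /\
  (Rabs y <= apriori_bound g M 1 /\ Rabs yb <= apriori_bound g M 1) /\
  (Rabs v <= apriori_bound g M 2 /\ Rabs vb <= apriori_bound g M 2) /\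
  (Rabs z <= apriori_bound g M 3 /\ Rabs zb <= apriori_bound g M 3).

Definition lipschitz_DM (f : R9 -> R) (g : R -> R) (M : R) (L : nat -> R) : Prop :=
  forall t u1 ub1 y1 yb1 v1 vb1 z1 zb1 u2 ub2 y2 yb2 v2 vb2 z2 zb2,
    DM g M (t, u1, ub1, y1, yb1, v1, vb1, z1, zb1) ->
    DM g M (t, u2, ub2, y2, yb2, v2, vb2, z2, zb2) ->
    Rabs (f (t, u2, ub2, y2, yb2, v2, vb2, z2, zb2)
          - f (t, u1, ub1, y1, yb1, v1, vb1, z1, zb1))
    <= L 0%nat * Rabs (u2 - u1) + L 1%nat * Rabs (ub2 - ub1)
       + L 2%nat * Rabs (y2 - y1) + L 3%nat * Rabs (yb2 - yb1)
       + L 4%nat * Rabs (v2 - v1) + L 5%nat * Rabs (vb2 - vb1)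
       + L 6%nat * Rabs (z2 - z1) + L 7%nat * Rabs (zb2 - zb1).

Definition bvp_solution (f : R9 -> R) (phi : nat -> R -> R) (a b c d : R)
    (u : R -> R) : Prop :=
  C4_01 u /\
  (forall t, 0 < t < 1 ->
     Derive01_n u 4 t =
     f (t, u t, u (phi 0%nat t),
        Derive01_n u 1 t, Derive01_n u 1 (phi 1%nat t),
        Derive01_n u 2 t, Derive01_n u 2 (phi 2%nat t),
        Derive01_n u 3 t, Derive01_n u 3 (phi 3%nat t))) /\
  u 0 = a /\ u 1 = b /\ Derive01_n u 1 0 = c /\ Derive01_n u 1 1 = d.

Definition estimate (g : R -> R) (M : R) (u : R -> R) : Prop :=
  forall i, (i <= 3)%nat -> forall t, I01 t ->
    Rabs (Derive01_n u i t) <= apriori_bound g M i.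

(* Main.v *)
Require Import Defs.
From Stdlib Require Import Reals Lra Lia.
From Coquelicot Require Import Coquelicot.
Open Scope R_scope.

(* The cubic g carries the boundary data, so a solution is g plus the clamped Green
   operator applied to the fourth derivative psi of u; followed by k derivatives,
   this operator has sup-norm at most M_k. Integrals of the Green kernel are
   estimated through primitives: if p is a cubic polynomial, then
   p D^3u - Dp D^2u + D^2p Du - D^3p u is a primitive of p psi, whose increments the
   mean value theorem bounds on the intervals where p has constant sign.
   Existence is Picard iteration on psi, which stays in the ball of radius M and
   contracts by the factor q; uniqueness iterates the same contraction on two
   solutions, starting from |psi_1 - psi_2| <= 2 M. *)

(** * Mean value inequalities *)

Lemma increasing_of_derive (F dF : R -> R) (x y : R) :
  x <= y ->
  (forall s, continuous F s) ->
  (forall s, x < s < y -> is_derive F s (dF s)) ->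
  (forall s, x < s < y -> 0 <= dF s) ->
  F x <= F y.
Proof.
intros Hxy cF HF Hpos.
destruct (Req_dec x y) as [->|Hne]; [lra|].
assert (pr : forall s, x < s < y -> derivable_pt F s).
{ intros s Hs; exists (dF s); apply is_derive_Reals; auto. }
destruct (MVT F id x y pr (fun s _ => derivable_pt_id s)) as [s [Hs E]].
- lra.
- intros s _; apply continuity_pt_filterlim, cF.
- intros s _; apply derivable_continuous_pt, derivable_pt_id.
- rewrite (derive_pt_eq_0 _ _ 1 (derivable_pt_id s)) in E
    by apply derivable_pt_lim_id.
  rewrite (derive_pt_eq_0 _ _ (dF s) (pr s Hs)) in E
    by (apply is_derive_Reals; auto).
  unfold id in E; specialize (Hpos s Hs); nra.
Qed.

(** Both [P - F] and [P + F] are nondecreasing. Derivatives are asked only inside the interval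
    because jets may lack them at 0 and 1. *)
Lemma increment_abs_le (F P dF dP : R -> R) (x y : R) :
  x <= y ->
  (forall s, continuous F s) -> (forall s, continuous P s) ->
  (forall s, x < s < y -> is_derive F s (dF s)) ->
  (forall s, x < s < y -> is_derive P s (dP s)) ->
  (forall s, x < s < y -> Rabs (dF s) <= dP s) ->
  Rabs (F y - F x) <= P y - P x.
Proof.
intros Hxy cF cP HF HP Hle.
assert (P x - F x <= P y - F y).
{ apply (increasing_of_derive (fun s => P s - F s) (fun s => dP s - dF s)); trivial.
  - intros s; apply (continuous_minus (V := R_NormedModule)); auto.
  - intros s Hs; apply (is_derive_minus (V := R_NormedModule)); auto.
  - intros s Hs; generalize (Hle s Hs); unfold Rabs; destruct Rcase_abs; lra. }
assert (P x + F x <= P y + F y).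
{ apply (increasing_of_derive (fun s => P s + F s) (fun s => dP s + dF s)); trivial.
  - intros s; apply (continuous_plus (V := R_NormedModule)); auto.
  - intros s Hs; apply (is_derive_plus (V := R_NormedModule)); auto.
  - intros s Hs; generalize (Hle s Hs); unfold Rabs; destruct Rcase_abs; lra. }
unfold Rabs; destruct Rcase_abs; lra.
Qed.

(** * A priori bounds for the clamped problem *)

(** A function with its derivatives up to order four, indexed by order. Continuity on all of R with
    differentiability only inside (0,1) admits functions extended from [0,1] by constants. *)
Definition jet (v : nat -> R -> R) : Prop :=
  (forall k, (k <= 3)%nat -> forall t, continuous (v k) t) /\
  (forall k, (k <= 3)%nat -> forall t, 0 < t < 1 -> is_derive (v k) t (v (S k) t)).

Definition boundary_data (a b c d : R) (v : nat -> R -> R) : Prop :=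
  v 0%nat 0 = a /\ v 0%nat 1 = b /\ v 1%nat 0 = c /\ v 1%nat 1 = d.

(* Repeated integration by parts: [bracket A B v t] is the integral over [0,t] of
   (A s^2 + B s^3) times the fourth derivative, if v and v' vanish at 0. *)
Definition bracket (A B : R) (v : nat -> R -> R) (s : R) : R :=
  (A * s ^ 2 + B * s ^ 3) * v 3%nat s - (2 * A * s + 3 * B * s ^ 2) * v 2%nat s
  + (2 * A + 6 * B * s) * v 1%nat s - 6 * B * v 0%nat s.

Lemma bracket_derive (A B : R) (v : nat -> R -> R) (s : R) :
  jet v -> 0 < s < 1 ->
  is_derive (bracket A B v) s ((A * s ^ 2 + B * s ^ 3) * v 4%nat s).
Proof.
intros [_ Dv] Hs; unfold bracket.
assert (D : forall k, (k <= 3)%nat -> ex_derive (v k) s /\ Derive (v k) s = v (S k) s).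
{ intros k Hk; split; [eexists; apply Dv; auto | apply is_derive_unique, Dv; auto]. }
destruct (D 0%nat) as [E0 D0]; [lia|]. destruct (D 1%nat) as [E1 D1]; [lia|].
destruct (D 2%nat) as [E2 D2]; [lia|]. destruct (D 3%nat) as [E3 D3]; [lia|].
auto_derive; [tauto|].
change (fun x => v ?k x) with (v k).
rewrite D0, D1, D2, D3; ring.
Qed.

Lemma bracket_continuous (A B : R) (v : nat -> R -> R) (s : R) :
  jet v -> continuous (bracket A B v) s.
Proof.
intros [cv _]; apply continuity_pt_filterlim; unfold bracket.
assert (c : forall k, (k <= 3)%nat -> continuity_pt (v k) s).
{ intros k Hk; apply continuity_pt_filterlim, cv, Hk. }
assert (p : forall h : R -> R, ex_derive h s -> continuity_pt h s).
{ intros h Hh; apply continuity_pt_filterlim.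
  now apply (ex_derive_continuous (V := R_NormedModule)). }
apply continuity_pt_minus; [apply continuity_pt_plus; [apply continuity_pt_minus|]|];
  apply continuity_pt_mult; try (apply c; lia); apply p; auto_derive; trivial.
Qed.

(** Since [s^2] is nonnegative, the weight [A s^2 + B s^3] has the sign of the affine factor
    [A + B s]; the right side is [K] times the integral of the weight over [x,y]. *)
Lemma bracket_increment (v : nat -> R -> R) (K A B x y : R) :
  jet v -> (forall s, 0 < s < 1 -> Rabs (v 4%nat s) <= K) ->
  0 <= x <= y -> y <= 1 -> (forall s, x < s < y -> 0 <= A + B * s) ->
  Rabs (bracket A B v y - bracket A B v x)
  <= K * (A * y ^ 3 / 3 + B * y ^ 4 / 4) - K * (A * x ^ 3 / 3 + B * x ^ 4 / 4).
Proof.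
intros J HK Hx Hy Hpos.
apply (increment_abs_le (bracket A B v) (fun s => K * (A * s ^ 3 / 3 + B * s ^ 4 / 4))
  (fun s => (A * s ^ 2 + B * s ^ 3) * v 4%nat s)
  (fun s => K * (A * s ^ 2 + B * s ^ 3))); [lra| | | | |].
- intros s; now apply bracket_continuous.
- intros s; apply (ex_derive_continuous (V := R_NormedModule)); auto_derive; trivial.
- intros s Hs; apply bracket_derive; trivial; lra.
- intros s Hs; auto_derive; trivial; field.
- intros s Hs.
  replace (A * s ^ 2 + B * s ^ 3) with (s ^ 2 * (A + B * s)) by ring.
  assert (0 <= s ^ 2 * (A + B * s)) by (apply Rmult_le_pos; [apply pow2_ge_0|auto]).
  rewrite Rabs_mult, Rabs_right, (Rmult_comm K) by lra.
  apply Rmult_le_compat_l; [lra|apply HK; lra].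
Qed.

Definition homogeneous_jet (K : R) (v : nat -> R -> R) : Prop :=
  jet v /\ boundary_data 0 0 0 0 v /\ (forall s, 0 < s < 1 -> Rabs (v 4%nat s) <= K).

Lemma bracket_0 (v : nat -> R -> R) (K A B : R) :
  homogeneous_jet K v -> bracket A B v 0 = 0.
Proof.
intros [_ [[H0 [_ [H1 _]]] _]]; unfold bracket; rewrite H0, H1; ring.
Qed.

Lemma bracket_opp (A B : R) (v : nat -> R -> R) (s : R) :
  bracket (- A) (- B) v s = - bracket A B v s.
Proof. unfold bracket; ring. Qed.

(** An affine factor nonnegative at 0 and at [t] is nonnegative in between, and the bracket vanishes
    at 0. *)
Lemma bracket_bound_pos (v : nat -> R -> R) (K A B t : R) :
  homogeneous_jet K v -> 0 <= t <= 1 -> 0 <= A -> 0 <= A + B * t ->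
  Rabs (bracket A B v t) <= K * (A * t ^ 3 / 3 + B * t ^ 4 / 4).
Proof.
intros H Ht HA HB.
assert (P : forall s, 0 < s < t -> 0 <= A + B * s) by (intros s Hs; nra).
generalize (bracket_increment v K A B 0 t (proj1 H) (proj2 (proj2 H))
  ltac:(lra) ltac:(lra) P).
rewrite (bracket_0 v K A B H), Rminus_0_r.
intros E; eapply Rle_trans; [exact E|]; right; field.
Qed.

Lemma bracket_bound_neg (v : nat -> R -> R) (K A B t : R) :
  homogeneous_jet K v -> 0 <= t <= 1 -> A <= 0 -> A + B * t <= 0 ->
  Rabs (bracket A B v t) <= - K * (A * t ^ 3 / 3 + B * t ^ 4 / 4).
Proof.
intros H Ht HA HB.
rewrite <- Rabs_Ropp, <- bracket_opp.
eapply Rle_trans; [apply (bracket_bound_pos v K); trivial; lra|right; field].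
Qed.

(** The weight is [B s^2 (s - z)], so the interval is cut at the sign change [z]. The weight
    integrates to [- B z^4 / 12] over [0,z]; counting this part positively adds twice that
    amount. *)
Lemma bracket_bound_change (v : nat -> R -> R) (K A B z t : R) :
  homogeneous_jet K v -> 0 <= z <= t -> t <= 1 -> 0 <= B -> A = - B * z ->
  Rabs (bracket A B v t)
  <= K * (A * t ^ 3 / 3 + B * t ^ 4 / 4 + B * z ^ 4 / 6).
Proof.
intros H Hz Ht HB HA.
assert (E1 := bracket_bound_neg v K A B z H ltac:(lra) ltac:(nra) ltac:(nra)).
assert (E2 : Rabs (bracket A B v t - bracket A B v z) <=
  K * (A * t ^ 3 / 3 + B * t ^ 4 / 4) - K * (A * z ^ 3 / 3 + B * z ^ 4 / 4)).
{ apply bracket_increment; try apply H; try lra; intros s Hs; nra. }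
replace (bracket A B v t) with
  (bracket A B v z + (bracket A B v t - bracket A B v z)) by ring.
eapply Rle_trans; [apply Rabs_triang|].
eapply Rle_trans; [apply Rplus_le_compat; [exact E1|exact E2]|].
right; rewrite HA; field.
Qed.

(** The substitution of [1 - t] for [t], with the sign the chain rule gives at order [k]. It
    exchanges the two endpoints and preserves the homogeneous problem. *)
Definition reflected (v : nat -> R -> R) (k : nat) (t : R) : R :=
  (-1) ^ k * v k (1 - t).

Lemma reflected_homogeneous (K : R) (v : nat -> R -> R) :
  homogeneous_jet K v -> homogeneous_jet K (reflected v).
Proof.
intros [[cv dv] [[Z1 [Z2 [Z3 Z4]]] HK]]; unfold reflected.
split; [split|split; [repeat split|]].
- intros k Hk t; apply (continuous_scal_r (V := R_NormedModule)).
  apply (continuous_comp (fun t => 1 - t) (v k)); [|apply cv, Hk].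
  apply (ex_derive_continuous (V := R_NormedModule)); auto_derive; trivial.
- intros k Hk t Ht.
  replace ((-1) ^ S k * v (S k) (1 - t)) with ((-1) ^ k * (-1 * v (S k) (1 - t)))
    by (simpl; ring).
  apply is_derive_scal.
  apply (is_derive_comp (v k) (fun t => 1 - t)); [apply dv; trivial; lra|].
  auto_derive; trivial; ring.
- rewrite Rminus_0_r, Z2; ring.
- rewrite Rminus_diag, Z1; ring.
- rewrite Rminus_0_r, Z4; ring.
- rewrite Rminus_diag, Z3; ring.
- intros s Hs; rewrite Rabs_mult, pow_1_abs, Rmult_1_l; apply HK; lra.
Qed.

(* For fixed t, the polynomials [A s^2 + B s^3] below are the t-derivatives of
   order 0, 1, 2, 3 of the clamped Green function on s <= t; the part s >= t is
   obtained by reflection. *)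
Lemma green_representation (v : nat -> R -> R) (t : R) :
  let r := 1 - t in
  v 0%nat t = bracket (r ^ 2 * t / 2) (- r ^ 2 * (1 + 2 * t) / 6) v t
     + bracket (t ^ 2 * r / 2) (- t ^ 2 * (1 + 2 * r) / 6) (reflected v) r /\
  v 1%nat t = bracket (r * (1 - 3 * t) / 2) (r * t) v t
     - bracket (t * (1 - 3 * r) / 2) (r * t) (reflected v) r /\
  v 2%nat t = bracket (3 * t - 2) (1 - 2 * t) v t
     + bracket (3 * r - 2) (1 - 2 * r) (reflected v) r /\
  v 3%nat t = bracket 3 (-2) v t - bracket 3 (-2) (reflected v) r.
Proof.
intros r; unfold bracket, reflected, r; replace (1 - (1 - t)) with t by ring.
repeat split; field.
Qed.

(** Here [15552 = 3 * 72^2]; the squared form keeps the square root out of later polynomial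
    inequalities. *)
Lemma Mconst_1_sqr : 0 < Mconst 1 /\ 15552 * Mconst 1 ^ 2 = 1.
Proof.
assert (0 < sqrt 3) by (apply sqrt_lt_R0; lra).
assert (sqrt 3 ^ 2 = 3) by (rewrite pow2_sqrt; lra).
simpl Mconst; split; [apply Rdiv_lt_0_compat; lra|].
replace (15552 * (1 / (72 * sqrt 3)) ^ 2) with (3 / sqrt 3 ^ 2) by (field; lra).
rewrite H0; field.
Qed.

Lemma Mconst_pos (k : nat) : 0 < Mconst k.
Proof.
destruct k as [|[|[|k]]]; [simpl; lra|apply Mconst_1_sqr|simpl; lra|simpl; lra].
Qed.

Lemma mul_compl_bounds (t : R) : 0 <= t <= 1 -> 0 <= t * (1 - t) <= 1 / 4.
Proof. intros Ht; pose proof (pow2_ge_0 (t - 1 / 2)); split; nra. Qed.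

(** The Green function itself keeps one sign, so the two brackets add up to [K (t (1 - t))^2 / 24],
    which is largest at [t = 1/2]. *)
Lemma homogeneous_jet_bound_0 (v : nat -> R -> R) (K t : R) :
  homogeneous_jet K v -> 0 <= K -> 0 <= t <= 1 -> Rabs (v 0%nat t) <= Mconst 0 * K.
Proof.
intros H HK Ht; destruct (green_representation v t) as [-> _]; simpl Mconst.
assert (H' := reflected_homogeneous K v H).
assert (T : 0 <= t * (1 - t) <= 1 / 4) by (now apply mul_compl_bounds).
eapply Rle_trans; [apply Rabs_triang|].
eapply Rle_trans; [apply Rplus_le_compat|].
- apply (bracket_bound_pos v K); trivial.
  + pose proof (pow2_ge_0 (1 - t)); nra.
  + replace (_ + _) with ((1 - t) ^ 2 * (t * (1 - t)) / 3) by field.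
    pose proof (pow2_ge_0 (1 - t)); nra.
- apply (bracket_bound_pos _ K); trivial; [lra| |].
  + pose proof (pow2_ge_0 t); nra.
  + replace (_ + _) with (t ^ 2 * (t * (1 - t)) / 3) by field.
    pose proof (pow2_ge_0 t); nra.
- rewrite <- Rmult_plus_distr_l, (Rmult_comm _ K).
  apply Rmult_le_compat_l; trivial.
  replace (_ + _) with ((t * (1 - t)) ^ 2 / 24) by field.
  nra.
Qed.

(** For [t <= 1/2] the weight on the reflected side keeps one sign, and the weight on the left side
    can change sign only when [t > 1/3]. The sharp constant comes from the case [t <= 1/3]. *)
Lemma homogeneous_jet_bound_1_half (v : nat -> R -> R) (K t : R) :
  homogeneous_jet K v -> 0 <= K -> 0 <= t <= 1 / 2 ->
  Rabs (v 1%nat t) <= Mconst 1 * K.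
Proof.
intros H HK Ht; destruct (green_representation v t) as [_ [-> _]].
destruct Mconst_1_sqr as [m0 m2]; set (m := Mconst 1) in *.
assert (H' := reflected_homogeneous K v H).
assert (0 <= t * (1 - t)) by nra.
assert (E' : Rabs (bracket (t * (1 - 3 * (1 - t)) / 2) ((1 - t) * t) (reflected v) (1 - t))
  <= - K * ((t * (1 - 3 * (1 - t)) / 2) * (1 - t) ^ 3 / 3 + (1 - t) * t * (1 - t) ^ 4 / 4)).
{ apply bracket_bound_neg; trivial; [lra|nra|].
  replace (_ + _) with (- (t ^ 2 * (1 - 2 * t) / 2)) by field.
  pose proof (pow2_ge_0 t); nra. }
unfold Rminus at 1.
eapply Rle_trans; [apply Rabs_triang|]; rewrite Rabs_Ropp.
destruct (Rle_dec t (1 / 3)) as [h|h].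
- eapply Rle_trans; [apply Rplus_le_compat; [|exact E']|].
  + apply (bracket_bound_pos v K); trivial; [lra|nra|].
    replace (_ + _) with ((1 - t) ^ 2 * (1 - 2 * t) / 2) by field.
    pose proof (pow2_ge_0 (1 - t)); nra.
  + replace (_ + _) with (K * (t * (1 - t) * (1 - 2 * t) / 12)) by field.
    rewrite (Rmult_comm m); apply Rmult_le_compat_l; trivial.
    set (y := t * (1 - t)) in *.
    assert (X : 0 <= y * (1 - 2 * t)) by nra.
    (* With [(1 - 2 t)^2 = 1 - 4 y] this is [108 y^2 (1 - 4 y) <= 1], an equality at the double root
       [y = 1/6]; and [15552 = 144 * 108] turns it into the bound by [m]. *)
    assert (X2 : 108 * (y * (1 - 2 * t)) ^ 2 <= 1).
    { apply Rminus_le; replace (_ - 1) with (- ((1 - 6 * y) ^ 2 * (1 + 12 * y)))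
        by (unfold y; ring).
      pose proof (pow2_ge_0 (1 - 6 * y)); nra. }
    nra.
(* The zero of the affine factor of the left weight. *)
- set (z := (3 * t - 1) / (2 * t)).
  assert (ez : 2 * t * z = 3 * t - 1) by (unfold z; field; lra).
  assert (z0 : 0 <= z) by nra.
  assert (zt : z <= t) by nra.
  eapply Rle_trans; [apply Rplus_le_compat; [|exact E']|].
  + apply (bracket_bound_change v K _ _ z); trivial; [lra|lra|nra|].
    replace (1 - 3 * t) with (- (2 * t * z)) by lra; field.
  + replace (_ + _) with (K * (t * (1 - t) * ((1 - 2 * t) + 2 * z ^ 4) / 12)) by field.
    rewrite (Rmult_comm m); apply Rmult_le_compat_l; trivial.
    (* Crude estimates suffice away from the maximum: they give [(1 - 2 t) + 2 z^4 <= 1/3], hence a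
       total of at most [K / 144], which is below [m K]. *)
    assert (z ^ 3 <= (1 / 2) ^ 3) by (apply pow_incr; lra).
    assert (z ^ 4 <= z / 8).
    { replace (z ^ 4) with (z * z ^ 3) by ring.
      replace (z / 8) with (z * (1 / 2) ^ 3) by field; nra. }
    assert (z <= (3 * t - 1) * (3 / 2)) by nra.
    assert (t * (1 - t) <= 1 / 4) by (apply mul_compl_bounds; lra).
    assert (0 <= z ^ 4) by (apply pow_le, z0).
    assert (1 / 144 <= m) by nra.
    nra.
Qed.

(** For [t <= 1/2] the left weight is nonpositive, and the reflected weight can change sign only
    when [t < 1/3]. *)
Lemma homogeneous_jet_bound_2_half (v : nat -> R -> R) (K t : R) :
  homogeneous_jet K v -> 0 <= K -> 0 <= t <= 1 / 2 ->
  Rabs (v 2%nat t) <= Mconst 2 * K.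
Proof.
intros H HK Ht; destruct (green_representation v t) as [_ [_ [-> _]]]; simpl Mconst.
assert (H' := reflected_homogeneous K v H).
assert (E : Rabs (bracket (3 * t - 2) (1 - 2 * t) v t)
  <= - K * ((3 * t - 2) * t ^ 3 / 3 + (1 - 2 * t) * t ^ 4 / 4)).
{ apply bracket_bound_neg; trivial; [lra|nra|nra]. }
eapply Rle_trans; [apply Rabs_triang|].
destruct (Rle_dec t (1 / 3)) as [h|h].
- set (z := (1 - 3 * t) / (1 - 2 * t)).
  assert (ez : (1 - 2 * t) * z = 1 - 3 * t) by (unfold z; field; lra).
  assert (z0 : 0 <= z) by nra.
  assert (zt : z <= 1 - t) by nra.
  (* The reflected weight passes from positive to negative at [z]; negating it gives the orientation
     that [bracket_bound_change] expects. *)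
  rewrite <- (Rabs_Ropp (bracket _ _ (reflected v) _)), <- bracket_opp.
  eapply Rle_trans; [apply Rplus_le_compat; [exact E|]|].
  + apply (bracket_bound_change _ K _ _ z); trivial; [lra|lra|nra|nra].
  + replace (_ + _) with (K * ((6 * t - 6 * t ^ 2 - 1 + 2 * (1 - 2 * t) * z ^ 4) / 12))
      by field.
    rewrite (Rmult_comm (1 / 12)); apply Rmult_le_compat_l; trivial.
    (* Trading one factor [z] for [1 - 3 t] and bounding [z^3] by 1 leaves [(1 - 6 t^2) / 12], whose
       maximum 1/12 is at [t = 0]. *)
    replace (2 * (1 - 2 * t) * z ^ 4) with (2 * ((1 - 2 * t) * z) * z ^ 3) by ring.
    rewrite ez.
    assert (z <= 1) by nra.
    assert (z ^ 3 <= 1 ^ 3) by (apply pow_incr; lra).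
    nra.
- eapply Rle_trans; [apply Rplus_le_compat; [exact E|]|].
  + apply (bracket_bound_neg _ K); trivial; [lra|nra|nra].
  + replace (_ + _) with (K * ((6 * t - 6 * t ^ 2 - 1) / 12)) by field.
    rewrite (Rmult_comm (1 / 12)); apply Rmult_le_compat_l; trivial; nra.
Qed.

(** The factor [3 - 2 s] is positive on [0,1], so neither bracket changes sign; the sum is largest
    at the endpoints. *)
Lemma homogeneous_jet_bound_3 (v : nat -> R -> R) (K t : R) :
  homogeneous_jet K v -> 0 <= K -> 0 <= t <= 1 -> Rabs (v 3%nat t) <= Mconst 3 * K.
Proof.
intros H HK Ht; destruct (green_representation v t) as [_ [_ [_ ->]]]; simpl Mconst.
assert (H' := reflected_homogeneous K v H).
unfold Rminus at 1.
eapply Rle_trans; [apply Rabs_triang|]; rewrite Rabs_Ropp.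
eapply Rle_trans; [apply Rplus_le_compat|].
- apply (bracket_bound_pos v K); trivial; lra.
- apply (bracket_bound_pos _ K); trivial; lra.
- replace (_ + _) with (K * (1 / 2 - (t * (1 - t)) * (1 + t * (1 - t)))) by field.
  rewrite (Rmult_comm (1 / 2)); apply Rmult_le_compat_l; trivial.
  assert (0 <= t * (1 - t)) by (now apply mul_compl_bounds); nra.
Qed.

(** For orders 1 and 2 the case [t > 1/2] follows from the other half by reflection. *)
Lemma homogeneous_jet_bound (v : nat -> R -> R) (K t : R) (k : nat) :
  homogeneous_jet K v -> (k <= 3)%nat -> I01 t -> Rabs (v k t) <= Mconst k * K.
Proof.
intros H Hk Ht; unfold I01 in Ht.
assert (HK : 0 <= K).
{ eapply Rle_trans; [apply Rabs_pos|]; apply (proj2 (proj2 H) (1 / 2)); lra. }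
assert (E : Rabs (v k t) = Rabs (reflected v k (1 - t))).
{ unfold reflected; rewrite Rabs_mult, pow_1_abs, Rmult_1_l; do 2 f_equal; ring. }
assert (H' := reflected_homogeneous K v H).
destruct k as [|[|[|[|k]]]];
  [now apply homogeneous_jet_bound_0| | |now apply homogeneous_jet_bound_3|lia];
  (destruct (Rle_dec t (1 / 2)) as [h|h]; [|rewrite E]);
  (apply homogeneous_jet_bound_1_half || apply homogeneous_jet_bound_2_half); trivial; lra.
Qed.

(** * Continuity and extension from [0,1] *)

Lemma continuous_on_comp {U V : UniformSpace} (D : U -> Prop) (F : U -> V) (h : R -> U)
    (t : R) :
  (forall s, D (h s)) -> continuous h t -> continuous_on D F ->
  continuous (fun s => F (h s)) t.
Proof.
intros HD Hh HF; refine (filterlim_comp _ _ _ h F _ _ _ _ (HF _ (HD t))).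
intros P HP; specialize (Hh _ HP); unfold filtermap in *; revert Hh.
apply filter_imp; intros s Hs; exact (Hs (HD s)).
Qed.

Lemma continuous_pair {U V : UniformSpace} (h : R -> U) (k : R -> V) (t : R) :
  continuous h t -> continuous k t -> continuous (fun s => (h s, k s)) t.
Proof.
intros Hh Hk P [e He].
refine (filterlim_pair h k Hh Hk P _).
exists (ball (h t) e) (ball (k t) e); try apply locally_ball.
intros x y Hx Hy; apply He; split; assumption.
Qed.

(** The retraction of R onto [0,1]: composing with it turns continuity relative to [0,1] into
    continuity on R. *)
Definition clamp (t : R) : R := Rmax 0 (Rmin 1 t).

Lemma clamp_I01 (t : R) : I01 (clamp t).
Proof. unfold I01, clamp, Rmax, Rmin; repeat destruct Rle_dec; lra. Qed.

Lemma clamp_id (t : R) : I01 t -> clamp t = t.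
Proof. unfold I01, clamp, Rmax, Rmin; repeat destruct Rle_dec; lra. Qed.

Lemma clamp_continuous (t : R) : continuous clamp t.
Proof.
intros P [e He]; exists e; intros s Hs; apply He.
change (Rabs (clamp s - clamp t) < e); change (Rabs (s - t) < e) in Hs.
revert Hs; unfold clamp, Rmax, Rmin, Rabs.
repeat destruct Rle_dec; repeat destruct Rcase_abs; lra.
Qed.

(** * The linear problem *)

Lemma iterated_derivatives (P : nat -> R -> R) (h : R -> R) (k : nat) (t : R) :
  (forall s, h s = P 0%nat s) ->
  (forall j s, is_derive (P j) s (P (S j) s)) ->
  Derive_n h k t = P k t.
Proof.
intros H0 HP; revert t; induction k as [|k IH]; intros t; [apply H0|].
simpl; rewrite (Derive_ext _ (P k)) by exact IH.
apply is_derive_unique, HP.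
Qed.

Lemma cubic_derivatives (a b c d : R) (g : R -> R) :
  cubic_interpolant a b c d g ->
  boundary_data a b c d (Derive_n g) /\
  (forall t, Derive_n g 4 t = 0) /\
  (forall k t, is_derive (Derive_n g k) t (Derive_n g (S k) t)).
Proof.
intros [[c0 [c1 [c2 [c3 Hg]]]] bd].
pose (P := fun (k : nat) t => match k with
  | 0 => c0 + c1 * t + c2 * t ^ 2 + c3 * t ^ 3
  | 1 => c1 + 2 * c2 * t + 3 * c3 * t ^ 2
  | 2 => 2 * c2 + 6 * c3 * t
  | 3 => 6 * c3
  | _ => 0 end).
assert (HP : forall k t, is_derive (P k) t (P (S k) t)).
{ intros k t; destruct k as [|[|[|[|k]]]]; unfold P; auto_derive; trivial; ring. }
assert (E : forall k t, Derive_n g k t = P k t).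
{ intros k t; now apply iterated_derivatives. }
split; [exact bd|split].
- intros t; now rewrite E.
- intros k t; rewrite E.
  apply (is_derive_ext (P k)); [intros s; now rewrite E|apply HP].
Qed.

Definition prim (h : R -> R) (t : R) : R := RInt h 0 t.

Lemma prim_derive (h : R -> R) (t : R) :
  (forall s, continuous h s) -> is_derive (prim h) t (h t).
Proof.
intros Hh; apply (is_derive_RInt h (prim h) 0); [|apply Hh].
apply filter_forall; intros s; apply (RInt_correct (V := R_CompleteNormedModule)).
apply (ex_RInt_continuous (V := R_CompleteNormedModule)); auto.
Qed.

Lemma prim_continuous (h : R -> R) :
  (forall s, continuous h s) -> forall t, continuous (prim h) t.
Proof.
intros Hh t; apply (ex_derive_continuous (V := R_NormedModule)).
eexists; now apply prim_derive.
Qed.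

Lemma prim_0 (h : R -> R) : prim h 0 = 0.
Proof. apply (RInt_point 0 h). Qed.

(* The multiples of t^2 and t^3 cancel the value and the slope at 1 of the fourfold
   primitive of [psi]. *)
Definition clamped_solution (psi : R -> R) (k : nat) (t : R) : R :=
  let p := prim (prim (prim psi)) 1 in
  let q := prim (prim (prim (prim psi))) 1 in
  match k with
  | 0 => prim (prim (prim (prim psi))) t + (p - 3 * q) * t ^ 2 + (2 * q - p) * t ^ 3
  | 1 => prim (prim (prim psi)) t + 2 * (p - 3 * q) * t + 3 * (2 * q - p) * t ^ 2
  | 2 => prim (prim psi) t + 2 * (p - 3 * q) + 6 * (2 * q - p) * t
  | 3 => prim psi t + 6 * (2 * q - p)
  | _ => psi t
  end.

Lemma clamped_solution_boundary (psi : R -> R) :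
  boundary_data 0 0 0 0 (clamped_solution psi).
Proof.
unfold clamped_solution; repeat split; rewrite ?prim_0; ring.
Qed.

Lemma clamped_solution_derive (psi : R -> R) (k : nat) (t : R) :
  (forall s, continuous psi s) -> (k <= 3)%nat ->
  is_derive (clamped_solution psi k) t (clamped_solution psi (S k) t).
Proof.
intros c0 Hk.
assert (c1 := prim_continuous _ c0); assert (c2 := prim_continuous _ c1).
assert (c3 := prim_continuous _ c2).
assert (add : forall h dh l dl, is_derive h t dh -> is_derive l t dl ->
  is_derive (fun s => h s + l s) t (dh + dl)).
{ intros h dh l dl; apply (is_derive_plus (V := R_NormedModule)). }
destruct k as [|[|[|[|k]]]]; [| | | |lia]; unfold clamped_solution;
  rewrite ?Rplus_assoc.
1-3: eapply is_derive_ext; [intros s; symmetry; apply Rplus_assoc|];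
  apply add; [now apply prim_derive|auto_derive; trivial; ring].
rewrite <- (Rplus_0_r (psi t)).
  apply add; [now apply prim_derive|auto_derive; trivial].
Qed.

(** For continuous [psi], the solution of the linear equation with fourth derivative [psi] and the
    given boundary data, together with its derivatives. *)
Definition bvp_jet (g psi : R -> R) (k : nat) (t : R) : R :=
  Derive_n g k t + clamped_solution psi k t.

Lemma bvp_jet_spec (a b c d : R) (g psi : R -> R) :
  cubic_interpolant a b c d g -> (forall s, continuous psi s) ->
  boundary_data a b c d (bvp_jet g psi) /\
  (forall t, bvp_jet g psi 4 t = psi t) /\
  (forall k t, (k <= 3)%nat ->
     is_derive (bvp_jet g psi k) t (bvp_jet g psi (S k) t)).
Proof.
intros Hg cpsi; destruct (cubic_derivatives _ _ _ _ _ Hg) as [[g1 [g2 [g3 g4]]] [z dg]].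
destruct (clamped_solution_boundary psi) as [s1 [s2 [s3 s4]]].
unfold bvp_jet; split; [|split].
- repeat split; [rewrite g1, s1|rewrite g2, s2|rewrite g3, s3|rewrite g4, s4]; ring.
- intros t; rewrite z; simpl; ring.
- intros k t Hk; apply (is_derive_plus (V := R_NormedModule)); [apply dg|].
  now apply clamped_solution_derive.
Qed.

Lemma jet_of_derive (v : nat -> R -> R) :
  (forall k t, (k <= 3)%nat -> is_derive (v k) t (v (S k) t)) -> jet v.
Proof.
intros H; split; intros k Hk t; [|intros _; auto].
apply (ex_derive_continuous (V := R_NormedModule)); eexists; auto.
Qed.

Lemma homogeneous_minus (a b c d K : R) (u w : nat -> R -> R) :
  jet u -> jet w -> boundary_data a b c d u -> boundary_data a b c d w ->
  (forall s, 0 < s < 1 -> Rabs (u 4%nat s - w 4%nat s) <= K) ->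
  homogeneous_jet K (fun k t => u k t - w k t).
Proof.
intros [cu du] [cw dw] [u1 [u2 [u3 u4]]] [w1 [w2 [w3 w4]]] HK.
split; [split|split; [repeat split; lra|exact HK]].
- intros k Hk t; apply (continuous_minus (V := R_NormedModule)); auto.
- intros k Hk t Ht; apply (is_derive_minus (V := R_NormedModule)); auto.
Qed.

(** Subtracting the cubic [g] makes the boundary data homogeneous and leaves the fourth derivative
    unchanged. *)
Lemma jet_bound (a b c d M : R) (g : R -> R) (u : nat -> R -> R) :
  cubic_interpolant a b c d g -> jet u -> boundary_data a b c d u ->
  (forall s, 0 < s < 1 -> Rabs (u 4%nat s) <= M) ->
  forall k t, (k <= 3)%nat -> I01 t -> Rabs (u k t) <= apriori_bound g M k.
Proof.
intros Hg Ju Bu HM k t Hk Ht.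
destruct (cubic_derivatives _ _ _ _ _ Hg) as [Bg [z dg]].
assert (Jg : jet (Derive_n g)) by (apply jet_of_derive; auto).
assert (H : homogeneous_jet M (fun k t => u k t - Derive_n g k t)).
{ apply (homogeneous_minus a b c d); trivial.
  intros s Hs; rewrite z, Rminus_0_r; auto. }
replace (u k t) with (Derive_n g k t + (u k t - Derive_n g k t)) by ring.
eapply Rle_trans; [apply Rabs_triang|]; apply Rplus_le_compat.
- apply (norm01_is_max (Derive_n g k)); trivial.
  intros s _; now apply continuity_pt_filterlim, Jg.
- now apply (homogeneous_jet_bound _ M t k H).
Qed.

(** * The right-hand side along a trajectory *)

Definition trajectory (phi : nat -> R -> R) (v : nat -> R -> R) (t : R) : R9 :=
  (t, v 0%nat t, v 0%nat (phi 0%nat t), v 1%nat t, v 1%nat (phi 1%nat t),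
   v 2%nat t, v 2%nat (phi 2%nat t), v 3%nat t, v 3%nat (phi 3%nat t)).

Lemma trajectory_continuous (f : R9 -> R) (phi v : nat -> R -> R) (t : R) :
  continuous_on dom01 f ->
  (forall k, (k <= 3)%nat ->
     continuous_on I01 (phi k) /\ (forall t, I01 t -> I01 (phi k t))) ->
  (forall k, (k <= 3)%nat -> forall t, continuous (v k) t) ->
  continuous (fun s => f (trajectory phi v (clamp s))) t.
Proof.
intros Hf Hphi Hv.
apply (continuous_on_comp dom01 f (fun s => trajectory phi v (clamp s)));
  [intros s; exact (clamp_I01 s)| |exact Hf].
assert (c1 : forall k, (k <= 3)%nat -> continuous (fun s => v k (clamp s)) t).
{ intros k Hk; apply (continuous_comp clamp (v k)); [apply clamp_continuous|auto]. }
assert (c2 : forall k, (k <= 3)%nat -> continuous (fun s => v k (phi k (clamp s))) t).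
{ intros k Hk; apply (continuous_comp (fun s => phi k (clamp s)) (v k)); [|auto].
  apply (continuous_on_comp I01 (phi k) clamp); [apply clamp_I01|apply clamp_continuous|].
  now apply Hphi. }
unfold trajectory; repeat (apply @continuous_pair);
  try (apply c1; lia); try (apply c2; lia); apply clamp_continuous.
Qed.

Lemma le_0_of_geometric (x C q : R) :
  0 <= q < 1 -> (forall n, x <= C * q ^ n) -> x <= 0.
Proof.
intros Hq H.
assert (lim : is_lim_seq (fun n => C * q ^ n) (C * 0)).
{ apply (is_lim_seq_scal_l _ C 0), is_lim_seq_geom; rewrite Rabs_right; lra. }
rewrite Rmult_0_r in lim.
exact (is_lim_seq_le (fun _ => x) _ x 0 H (is_lim_seq_const x) lim).
Qed.

(** * One-sided and two-sided derivatives *)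

Lemma within_I01_proper (t : R) : I01 t -> ProperFilter (within I01 (locally t)).
Proof.
intros Ht; split; [|apply within_filter, locally_filter].
intros P HP; exists t; exact (locally_singleton t _ HP Ht).
Qed.

Lemma within_I01_lim (t : R) : is_filter_lim (within I01 (locally t)) t.
Proof. intros P HP; unfold within; revert HP; apply filter_imp; auto. Qed.

Lemma is_derive01_of_is_derive (u : R -> R) (t l : R) :
  I01 t -> is_derive u t l -> is_derive01 u t l.
Proof.
intros Ht [Hl Hd]; split; [exact Hl|]; intros x Hx.
assert (PF := within_I01_proper t Ht).
(* [filterdiff] quantifies over every limit of the filter; properness and separation leave only
   [t]. *)
assert (E : t = x).
{ apply (is_filter_lim_unique (V := R_NormedModule) (F := within I01 (locally t)));
    [apply within_I01_lim|exact Hx]. }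
subst x; intros e.
apply filter_le_within, (Hd t (fun P HP => HP) e).
Qed.

Lemma is_derive_of_is_derive01 (u : R -> R) (t l : R) :
  0 < t < 1 -> is_derive01 u t l -> is_derive u t l.
Proof.
intros Ht [Hl Hd]; split; [exact Hl|]; intros x Hx.
assert (E : t = x).
{ apply (is_filter_lim_unique (V := R_NormedModule) (F := locally t));
    [exact (fun P HP => HP)|exact Hx]. }
subst x; intros e.
(* At an interior point [0,1] is a neighbourhood, so restricting the filter to it changes
   nothing. *)
assert (N : locally t I01).
{ assert (p : 0 < Rmin t (1 - t)) by (apply Rmin_glb_lt; lra).
  exists (mkposreal _ p); intros s Hs.
  change (Rabs (s - t) < Rmin t (1 - t)) in Hs.
  pose proof (Rmin_l t (1 - t)); pose proof (Rmin_r t (1 - t)).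
  apply Rabs_def2 in Hs; unfold I01; lra. }
generalize (filter_and _ _ N (Hd t (within_I01_lim t) e)).
apply filter_imp; intros s [Hs Ks]; exact (Ks Hs).
Qed.

Lemma is_derive01_ext (u w : R -> R) (t l : R) :
  I01 t -> (forall s, I01 s -> u s = w s) -> is_derive01 u t l -> is_derive01 w t l.
Proof.
intros Ht E; apply filterdiff_ext_loc.
- apply (filter_forall (F := locally t)); exact E.
- intros x Hx; apply E.
  assert (PF := within_I01_proper t Ht).
  assert (Et : t = x); [|now rewrite <- Et].
  apply (is_filter_lim_unique (V := R_NormedModule) (F := within I01 (locally t)));
    [apply within_I01_lim|exact Hx].
Qed.

Lemma Derive01_correct (u : R -> R) (t : R) :
  I01 t -> ex_derive01 u t -> is_derive01 u t (Derive01 u t).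
Proof. intros Ht [l Hl]; now rewrite (is_derive01_unique u t l). Qed.

Lemma continuous_on_of_ex_derive01 (u : R -> R) :
  (forall t, I01 t -> ex_derive01 u t) -> continuous_on I01 u.
Proof.
intros H t Ht; destruct (H t Ht) as [l Hl].
apply (filterdiff_continuous_aux (F := within I01 (locally t)) u);
  [eexists; exact Hl|apply within_I01_lim].
Qed.

Lemma Derive01_n_jet (v : nat -> R -> R) (k : nat) (t : R) :
  (forall k t, (k <= 3)%nat -> is_derive (v k) t (v (S k) t)) ->
  (k <= 4)%nat -> I01 t -> Derive01_n (v 0%nat) k t = v k t.
Proof.
intros H; revert t; induction k as [|k IH]; intros t Hk Ht; [easy|].
apply is_derive01_unique; [exact Ht|].
apply (is_derive01_ext (v k)); [exact Ht| |].
- intros s Hs; symmetry; apply IH; trivial; lia.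
- apply is_derive01_of_is_derive; trivial; apply H; lia.
Qed.

Lemma C4_01_jet (v : nat -> R -> R) :
  (forall k t, (k <= 3)%nat -> is_derive (v k) t (v (S k) t)) ->
  (forall t, continuous (v 4%nat) t) -> C4_01 (v 0%nat).
Proof.
intros H c; split.
- intros k Hk t Ht; exists (v (S k) t).
  apply (is_derive01_ext (v k)); [exact Ht| |].
  + intros s Hs; symmetry; apply Derive01_n_jet; trivial; lia.
  + apply is_derive01_of_is_derive; trivial; apply H; lia.
- intros t Ht; rewrite (Derive01_n_jet v) by (trivial; lia).
  apply (filterlim_within_ext (F := locally t) I01 (v 4%nat)).
  + intros s Hs; symmetry; apply Derive01_n_jet; trivial; lia.
  + apply (filterlim_filter_le_1 (F := locally t)); [apply filter_le_within|apply c].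
Qed.

(** Clamping makes the one-sided derivatives continuous on R; on (0,1) they are ordinary
    derivatives. *)
Lemma jet_of_C4_01 (w : R -> R) :
  C4_01 w -> jet (fun k t => Derive01_n w k (clamp t)).
Proof.
intros [D _]; split; intros k Hk t.
- apply (continuous_on_comp I01 (Derive01_n w k) clamp);
    [apply clamp_I01|apply clamp_continuous|].
  apply continuous_on_of_ex_derive01; intros s Hs; apply D; trivial; lia.
- intros Ht; assert (It : I01 t) by (unfold I01; lra).
  apply is_derive_of_is_derive01; [exact Ht|].
  apply (is_derive01_ext (Derive01_n w k)); [exact It| |].
  + intros s Hs; now rewrite clamp_id.
  + rewrite (clamp_id t It); apply Derive01_correct; [exact It|].
    apply D; trivial; lia.
Qed.

(** * Picard iteration *)

Definition contraction_factor (L : nat -> R) : R :=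
  (L 0%nat + L 1%nat) * Mconst 0 + (L 2%nat + L 3%nat) * Mconst 1
  + (L 4%nat + L 5%nat) * Mconst 2 + (L 6%nat + L 7%nat) * Mconst 3.

Lemma contraction_factor_pos (L : nat -> R) :
  (forall i, (i <= 7)%nat -> 0 <= L i) -> 0 <= contraction_factor L.
Proof.
intros HL; unfold contraction_factor.
assert (H : forall i j k, (i <= 7)%nat -> (j <= 7)%nat -> 0 <= (L i + L j) * Mconst k).
{ intros i j k Hi Hj; apply Rmult_le_pos; [|apply Rlt_le, Mconst_pos].
  pose proof (HL i Hi); pose proof (HL j Hj); lra. }
repeat apply Rplus_le_le_0_compat; apply H; lia.
Qed.

Section Contraction.

Context (f : R9 -> R) (phi : nat -> R -> R) (a b c d M : R) (g : R -> R) (L : nat -> R).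

Hypothesis M_pos : 0 < M.
Hypothesis g_cubic : cubic_interpolant a b c d g.
Hypothesis f_continuous : continuous_on dom01 f.
Hypothesis phi_continuous : forall k, (k <= 3)%nat ->
  continuous_on I01 (phi k) /\ (forall t, I01 t -> I01 (phi k t)).
Hypothesis f_bounded : forall p, DM g M p -> Rabs (f p) <= M.
Hypothesis L_pos : forall i, (i <= 7)%nat -> 0 <= L i.
Hypothesis f_lipschitz : lipschitz_DM f g M L.

Definition in_range (v : nat -> R -> R) : Prop :=
  forall k t, (k <= 3)%nat -> I01 t -> Rabs (v k t) <= apriori_bound g M k.

Lemma trajectory_DM (v : nat -> R -> R) (t : R) :
  in_range v -> I01 t -> DM g M (trajectory phi v t).
Proof.
intros Hv Ht; unfold trajectory, DM.
split; [exact Ht|]; repeat split; apply Hv; trivial; try lia;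
  apply phi_continuous; trivial; lia.
Qed.

(** The difference of the two jets is homogeneous, so at order [k] it is at most [Mconst k * K], at
    [t] and at [phi k t] alike; the Lipschitz weights then sum to the contraction factor. Stated for
    arbitrary jets, it serves both existence and uniqueness. *)
Lemma rhs_contraction (u w : nat -> R -> R) (K t : R) :
  jet u -> jet w -> boundary_data a b c d u -> boundary_data a b c d w ->
  in_range u -> in_range w ->
  (forall s, 0 < s < 1 -> Rabs (u 4%nat s - w 4%nat s) <= K) -> I01 t ->
  Rabs (f (trajectory phi u t) - f (trajectory phi w t)) <= contraction_factor L * K.
Proof.
intros Ju Jw Bu Bw Ru Rw HK Ht.
assert (H := homogeneous_minus a b c d K u w Ju Jw Bu Bw HK).
assert (E : forall i k s, (i <= 7)%nat -> (k <= 3)%nat -> I01 s ->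
  L i * Rabs (u k s - w k s) <= L i * (Mconst k * K)).
{ intros i k s Hi Hk Hs; apply Rmult_le_compat_l; [now apply L_pos|].
  exact (homogeneous_jet_bound _ K s k H Hk Hs). }
assert (P : forall k, (k <= 3)%nat -> I01 (phi k t)).
{ intros k Hk; now apply phi_continuous. }
eapply Rle_trans; [apply f_lipschitz; now apply trajectory_DM|].
unfold contraction_factor.
pose proof (E 0%nat 0%nat t ltac:(lia) ltac:(lia) Ht).
pose proof (E 1%nat 0%nat _ ltac:(lia) ltac:(lia) (P 0%nat ltac:(lia))).
pose proof (E 2%nat 1%nat t ltac:(lia) ltac:(lia) Ht).
pose proof (E 3%nat 1%nat _ ltac:(lia) ltac:(lia) (P 1%nat ltac:(lia))).
pose proof (E 4%nat 2%nat t ltac:(lia) ltac:(lia) Ht).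
pose proof (E 5%nat 2%nat _ ltac:(lia) ltac:(lia) (P 2%nat ltac:(lia))).
pose proof (E 6%nat 3%nat t ltac:(lia) ltac:(lia) Ht).
pose proof (E 7%nat 3%nat _ ltac:(lia) ltac:(lia) (P 3%nat ltac:(lia))).
lra.
Qed.

Definition admissible (psi : R -> R) : Prop :=
  (forall t, continuous psi t) /\ (forall t, Rabs (psi t) <= M).

Lemma admissible_jet (psi : R -> R) :
  admissible psi ->
  jet (bvp_jet g psi) /\ boundary_data a b c d (bvp_jet g psi) /\ in_range (bvp_jet g psi).
Proof.
intros [cpsi bpsi].
destruct (bvp_jet_spec a b c d g psi g_cubic cpsi) as [B [E D]].
assert (J : jet (bvp_jet g psi)) by (apply jet_of_derive; auto).
split; [exact J|split; [exact B|]].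
intros k t; apply (jet_bound a b c d M g); trivial.
intros s _; rewrite E; apply bpsi.
Qed.

(** The clamp keeps the iterates defined, continuous and bounded on all of R. *)
Definition picard_step (psi : R -> R) (t : R) : R :=
  f (trajectory phi (bvp_jet g psi) (clamp t)).

Lemma picard_step_admissible (psi : R -> R) :
  admissible psi -> admissible (picard_step psi).
Proof.
intros H; destruct (admissible_jet psi H) as [J [B Rg]]; split; intros t.
- apply trajectory_continuous; trivial; apply J.
- apply f_bounded, trajectory_DM; [exact Rg|apply clamp_I01].
Qed.

Lemma picard_step_contraction (psi chi : R -> R) (K : R) :
  admissible psi -> admissible chi -> (forall t, Rabs (psi t - chi t) <= K) ->
  forall t, Rabs (picard_step psi t - picard_step chi t) <= contraction_factor L * K.
Proof.
intros H1 H2 HK t.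
destruct (admissible_jet psi H1) as [J1 [B1 R1]].
destruct (admissible_jet chi H2) as [J2 [B2 R2]].
apply rhs_contraction; trivial; [|apply clamp_I01].
destruct (bvp_jet_spec a b c d g psi g_cubic (proj1 H1)) as [_ [E1 _]].
destruct (bvp_jet_spec a b c d g chi g_cubic (proj1 H2)) as [_ [E2 _]].
intros s _; rewrite E1, E2; apply HK.
Qed.

Fixpoint picard (n : nat) : R -> R :=
  match n with
  | O => fun _ => 0
  | S m => picard_step (picard m)
  end.

Lemma picard_admissible (n : nat) : admissible (picard n).
Proof.
induction n as [|n IH]; [|now apply picard_step_admissible].
split; intros t; simpl; [apply continuous_const|rewrite Rabs_R0; lra].
Qed.

Hypothesis factor_lt_1 : contraction_factor L < 1.

(** The sequence starts at 0, so the distance from its first term to any other is at most [M]; each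
    further step gains one contraction factor. *)
Lemma picard_cauchy (n p : nat) (t : R) :
  Rabs (picard (n + p) t - picard n t) <= M * contraction_factor L ^ n.
Proof.
revert t; induction n as [|n IH]; intros t.
- simpl; rewrite Rminus_0_r, Rmult_1_r; apply picard_admissible.
- replace (M * contraction_factor L ^ S n)
    with (contraction_factor L * (M * contraction_factor L ^ n)) by (simpl; ring).
  apply picard_step_contraction; trivial; apply picard_admissible.
Qed.

Lemma picard_fixed_point :
  exists psi, admissible psi /\ forall t, picard_step psi t = psi t.
Proof.
set (q := contraction_factor L) in *.
assert (Hq : 0 <= q < 1) by (split; [now apply contraction_factor_pos|assumption]).
pose (psi := fun t => real (Lim_seq (fun n => picard n t))).
assert (U : CVU_dom picard (fun _ => True)).
{ apply CVU_dom_cauchy; intros e.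
  (* With this threshold, two distances to [picard N], each at most [M q^N], together stay below
     [e]. *)
  destruct (proj1 (is_lim_seq_Reals _ _) (is_lim_seq_geom q ltac:(rewrite Rabs_right; lra))
              (e / (2 * M))) as [N HN].
  { apply Rdiv_lt_0_compat; [apply cond_pos|lra]. }
  specialize (HN N (le_n N)); unfold Rdist in HN.
  rewrite Rminus_0_r, Rabs_right in HN by (apply Rle_ge, pow_le, Hq).
  assert (B : 2 * (M * q ^ N) < e).
  { apply (Rmult_lt_compat_r (2 * M)) in HN; [|lra].
    replace (e / (2 * M) * (2 * M)) with (pos e) in HN by (field; lra); lra. }
  exists N; intros n m t _ Hn Hm.
  replace (picard n t - picard m t)
    with ((picard n t - picard N t) - (picard m t - picard N t)) by ring.
  eapply Rle_lt_trans; [apply Rabs_triang|]; rewrite Rabs_Ropp.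
  pose proof (picard_cauchy N (n - N) t) as En; pose proof (picard_cauchy N (m - N) t) as Em.
  fold q in En, Em; replace (N + (n - N))%nat with n in En by lia.
  replace (N + (m - N))%nat with m in Em by lia; lra. }
(* Two consecutive iterates are controlled at once, because [picard (S n)] is the step applied to
   [picard n]. *)
assert (A : forall e : posreal, exists n, forall t, Rabs (picard n t - psi t) < e /\
   Rabs (picard (S n) t - psi t) < e).
{ intros e; destruct (U e) as [N HN]; exists N; intros t; split; apply HN; auto. }
assert (adm : admissible psi).
{ split; intros t.
  - apply continuity_pt_filterlim.
    apply (CVU_cont_open picard (fun _ => True)); trivial; [apply open_true|].
    intros n x _; apply continuity_pt_filterlim, picard_admissible.
  - apply le_epsilon; intros e He; destruct (A (mkposreal e He)) as [n Hn].
    destruct (Hn t) as [H _]; simpl in H.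
    generalize (proj2 (picard_admissible n) t); revert H.
    unfold Rabs; repeat destruct Rcase_abs; lra. }
exists psi; split; [exact adm|]; intros t.
apply Rminus_diag_uniq, Rabs_eq_0, Rle_antisym; [|apply Rabs_pos].
apply le_epsilon; intros e He; rewrite Rplus_0_l.
assert (e2 : 0 < e / 2) by lra.
destruct (A (mkposreal _ e2)) as [n Hn]; simpl in Hn.
(* Both [picard_step psi] and [psi] lie within [e / 2] of [picard (S n)]. *)
assert (C : Rabs (picard_step psi t - picard_step (picard n) t) <= q * (e / 2)).
{ apply picard_step_contraction; [exact adm|apply picard_admissible|].
  intros s; rewrite Rabs_minus_sym; apply Rlt_le, Hn. }
destruct (Hn t) as [_ H].
assert (q * (e / 2) <= e / 2) by nra.
replace (picard_step psi t - psi t)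
  with ((picard_step psi t - picard_step (picard n) t)
        + (picard_step (picard n) t - psi t)) by ring.
eapply Rle_trans; [apply Rabs_triang|]; lra.
Qed.

Lemma bvp_existence :
  exists u, bvp_solution f phi a b c d u /\ estimate g M u.
Proof.
destruct picard_fixed_point as [psi [adm fix_psi]].
destruct (admissible_jet psi adm) as [J [_ Rg]].
destruct (bvp_jet_spec a b c d g psi g_cubic (proj1 adm)) as [[b1 [b2 [b3 b4]]] [E D]].
assert (I : forall k t, (k <= 4)%nat -> I01 t ->
  Derive01_n (bvp_jet g psi 0) k t = bvp_jet g psi k t).
{ intros k t; apply Derive01_n_jet; auto. }
exists (bvp_jet g psi 0); split; [split; [|split; [|repeat split]]|]; trivial.
- apply C4_01_jet; [auto|]; intros t.
  apply (continuous_ext psi); [intros s; now rewrite E|apply adm].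
- intros t Ht; assert (It : I01 t) by (unfold I01; lra).
  assert (P : forall k, (k <= 3)%nat -> I01 (phi k t)).
  { intros k Hk; now apply phi_continuous. }
  rewrite !I, E by (trivial || lia || (apply P; lia)).
  rewrite <- fix_psi; unfold picard_step; now rewrite (clamp_id t It).
- rewrite I by (lia || unfold I01; lra); exact b3.
- rewrite I by (lia || unfold I01; lra); exact b4.
- intros k Hk t Ht; rewrite I by (trivial; lia); now apply Rg.
Qed.

(** * Uniqueness among solutions obeying the estimate *)

Definition jet01 (w : R -> R) (k : nat) (t : R) : R := Derive01_n w k (clamp t).

Lemma bvp_solution_jet (w : R -> R) :
  bvp_solution f phi a b c d w -> estimate g M w ->
  jet (jet01 w) /\ boundary_data a b c d (jet01 w) /\ in_range (jet01 w) /\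
  (forall t, 0 < t < 1 -> jet01 w 4 t = f (trajectory phi (jet01 w) t)).
Proof.
intros [Hw [eqn [w1 [w2 [w3 w4]]]]] est; unfold jet01.
split; [now apply jet_of_C4_01|split; [|split]].
- unfold boundary_data; rewrite !clamp_id by (unfold I01; lra); auto.
- intros k t Hk Ht; rewrite clamp_id by exact Ht; now apply est.
- intros t Ht; assert (It : I01 t) by (unfold I01; lra).
  assert (P : forall k, (k <= 3)%nat -> I01 (phi k t)).
  { intros k Hk; now apply phi_continuous. }
  unfold trajectory; rewrite !clamp_id by (trivial || (apply P; lia)); now apply eqn.
Qed.

Lemma bvp_uniqueness (u w : R -> R) (t : R) :
  bvp_solution f phi a b c d u -> estimate g M u ->
  bvp_solution f phi a b c d w -> estimate g M w -> I01 t -> w t = u t.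
Proof.
intros Su Eu Sw Ew Ht.
destruct (bvp_solution_jet u Su Eu) as [Ju [Bu [Ru Fu]]].
destruct (bvp_solution_jet w Sw Ew) as [Jw [Bw [Rw Fw]]].
set (q := contraction_factor L) in *.
(* The estimate keeps both trajectories in [DM g M], where the bound on [f] starts the induction and
   its Lipschitz condition continues it. *)
assert (D : forall n s, 0 < s < 1 -> Rabs (jet01 w 4 s - jet01 u 4 s) <= 2 * M * q ^ n).
{ induction n as [|n IH]; intros s Hs; assert (Is : I01 s) by (unfold I01; lra);
    rewrite Fu, Fw by exact Hs.
  - simpl; rewrite Rmult_1_r.
    pose proof (f_bounded _ (trajectory_DM _ s Ru Is)).
    pose proof (f_bounded _ (trajectory_DM _ s Rw Is)).
    eapply Rle_trans; [apply Rabs_triang|]; rewrite Rabs_Ropp; lra.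
  - replace (2 * M * q ^ S n) with (q * (2 * M * q ^ n)) by (simpl; ring).
    now apply rhs_contraction. }
apply Rminus_diag_uniq, Rabs_eq_0, Rle_antisym; [|apply Rabs_pos].
(* The order 0 bound carries the geometric decay from the fourth derivatives to [w - u]. *)
apply (le_0_of_geometric _ (Mconst 0 * (2 * M)) q).
{ split; [now apply contraction_factor_pos|assumption]. }
intros n; rewrite Rmult_assoc, <- (clamp_id t Ht).
apply (homogeneous_jet_bound _ _ t 0
  (homogeneous_minus a b c d _ _ _ Jw Ju Bw Bu (D n))); [lia|exact Ht].
Qed.

End Contraction.

(* Uniqueness is among the solutions obeying the estimate, equivalently those
   whose trajectory stays in [DM g M]: the hypotheses do not constrain [f]
   outside [DM g M] beyond continuity, and other solutions may exist there. *)
Theorem theorem2p2 :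
  forall (f : R9 -> R) (phi : nat -> R -> R) (a b c d M : R)
         (g : R -> R) (L : nat -> R),
    continuous_on dom01 f ->
    0 < M ->
    cubic_interpolant a b c d g ->
    (forall k, (k <= 3)%nat ->
       continuous_on I01 (phi k) /\ (forall t, I01 t -> I01 (phi k t))) ->
    continuous_on (DM g M) f ->
    (forall p, DM g M p -> Rabs (f p) <= M) ->
    (forall i, (i <= 7)%nat -> 0 <= L i) ->
    lipschitz_DM f g M L ->
    (L 0%nat + L 1%nat) * Mconst 0 + (L 2%nat + L 3%nat) * Mconst 1
      + (L 4%nat + L 5%nat) * Mconst 2 + (L 6%nat + L 7%nat) * Mconst 3 < 1 ->
    exists u : R -> R,
      (bvp_solution f phi a b c d u /\ estimate g M u) /\
      (forall w : R -> R,
         bvp_solution f phi a b c d w -> estimate g M w ->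
         forall t, I01 t -> w t = u t).
Proof.
intros f phi a b c d M g L Hf HM Hg Hphi _ Hb HL Hlip Hq.
destruct (bvp_existence f phi a b c d M g L) as [u [Su Eu]]; trivial.
exists u; split; [now split|]; intros w Sw Ew t Ht.
now apply (bvp_uniqueness f phi a b c d M g L).
Qed.
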